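(* Let a nonlinear regression model with $m$ parameters, whose local $D$-optimal designs depend only on one component $\beta$ of the parameter, be given on a compact design space $\mathcal{X}$, with information matrices $M(\xi,\beta)$, $\beta\in\mathcal{B}=[\beta_{\min},\beta_{\max}]$ (where $-\infty\le\beta_{\min}\le\beta_{\max}\le\infty$), and local $D$-optimal designs $\xi[\beta]$, and let $Q(\beta,\tilde\beta)=|M(\xi[\tilde\beta],\beta)|/|M(\xi[\beta],\beta)|$ (see context). Let $\pi$ be a prior (probability measure) on $\mathcal{B}$. Assume the following. (i) There is a constant $c_0$ such that for any $(x_1,\dots,x_m)\in\mathcal{X}^m$ there exist local $D$-optimal designs $\xi[\tilde\beta^{(1)}],\dots,\xi[\tilde\beta^{(m)}]$ with $\tilde\beta^{(1)},\dots,\tilde\beta^{(m)}\in\mathcal{B}$ such that $$|I_m(x_1,\dots,x_m,\beta)|\le c_0\sum_{j=1}^m|M(\xi[\tilde\beta^{(j)}],\beta)|\qquad\text{for all }\beta\in\mathcal{B}.$$ (ii) $Q$ is uniformly decreasing with respect to a scale $\ell$, where $\ell:\mathcal{B}\to\mathbb{R}$ is a nondecreasing continuous function; that is, for all $\beta,\tilde\beta\in\mathcal{B}$, $$Q(\beta,\tilde\beta)\le\varphi(\ell(\beta)-\ell(\tilde\beta)),$$ where $\varphi$ is a real-valued function satisfying $\varphi(z)\le c_1e^{-|z|^{\gamma}}$ for some positive constants $c_1,\gamma$, and there is a constant $\lambda>0$ such that $Q(\beta,\tilde\beta)\ge\frac12$ whenever $|\ell(\beta)-\ell(\tilde\beta)|\le\lambda$.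 (iii) The prior $\pi$ and the function $\ell$ satisfy, for all measurable sets $A\subset\mathcal{B}$, $$\int_A\frac{c_3}{\ell(\mathcal{B})}\,\ell(d\beta)\le\int_A\pi(d\beta)$$ for some positive constant $c_3$, where $\ell(d\beta)$ is the measure induced by the nondecreasing function $\ell$ and $\ell(\mathcal{B})=\ell(\beta_{\max})-\ell(\beta_{\min})$. Let $N\in\mathbb{N}$ be given. If $\ell(\beta_{\max})-\ell(\beta_{\min})$ is sufficiently large, then the Bayesian $D$-optimal design with respect to the prior $\pi$ on the interval $\mathcal{B}$ is supported at more than $N$ points.
   Context: Setting. The response $Y$ is distributed as a member of the exponential family with $E[Y|x]=\eta(x,\theta)$, where $\theta\in\mathbb{R}^m$ is the unknown parameter, $x$ varies in a compact space $\mathcal{X}$, $\eta$ is continuously differentiable with respect to $\theta$, and the conditional variance $\mathrm{Var}[Y|x]$ exists. Observations under different experimental conditions are independent. The Fisher information at $x$ is $\frac{1}{\mathrm{Var}[Y|x]}\big(\frac{\partial\eta}{\partial\theta}(x,\theta)\big)\big(\frac{\partial\eta}{\partial\theta}(x,\theta)\big)^T\in\mathbb{R}^{m\times m}$. It is assumed that the local $D$-optimal design depends only on one component $\beta$ of $\theta$, and only this dependence is reflected in the notation: the Fisher information is written $I(x,\beta)=f(x,\beta)f^T(x,\beta)$ with $f(x,\beta)=(f_1(x,\beta),\dots,f_m(x,\beta))^T\in\mathbb{R}^m$. Designs. An (approximate) design $\xi$ is a probability measure on $\mathcal{X}$ with finite support $x_1,\dots,x_n$ and weights $w_1,\dots,w_n$.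 Its information matrix is $M(\xi,\beta)=\int_{\mathcal{X}}I(x,\beta)\,d\xi(x)=\sum_{k=1}^n w_kI(x_k,\beta)$. $|\cdot|$ applied to a matrix denotes the determinant. For each $\beta$, $\xi[\beta]$ denotes the local $D$-optimal design, i.e. the design maximizing $|M(\xi,\beta)|$ over all designs $\xi$. Criterion. A design is Bayesian $D$-optimal with respect to the prior $\pi$ on $\mathcal{B}$ if it maximizes, over all designs $\xi$, $$\Psi(\xi)=\int_{\mathcal{B}}\log|M(\xi,\beta)|\,\pi(d\beta).$$ Notation. For $x_1,\dots,x_m\in\mathcal{X}$, $I_m(x_1,\dots,x_m,\beta)=\big(\det(f_i(x_j,\beta))_{i,j=1}^m\big)^2$. Standing assumption: the number $m_\eta\ge0$ of points that are support points of every local $D$-optimal design in the model satisfies $m>m_\eta$. *)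

(* Defs.v *)
From HB Require Import structures.
From mathcomp Require Import all_boot all_order all_algebra.
From mathcomp Require Import all_classical all_reals all_analysis.
Set Implicit Arguments.
Unset Strict Implicit.
Unset Printing Implicit Defensive.
Import Order.TTheory GRing.Theory Num.Theory.
Import numFieldNormedType.Exports.
Local Open Scope classical_set_scope.
Local Open Scope ring_scope.

(* One-parameter exponential family in the response [y] itself: this is the
   class in which the Fisher information is grad eta (grad eta)^T / Var.  A
   dispersion parameter can be absorbed in [nu], [kappa] and [psi]. *)
Definition exponential_family (R : realType) (P : Type) (D : set P)
    (law : P -> probability (measurableTypeR R) R) : Prop :=
  exists (nu : {sigma_finite_measure set (measurableTypeR R) -> \bar R})
         (kappa psi : P -> R),
    forall th, D th -> forall A : set (measurableTypeR R), measurable A ->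
      law th A = (\int[nu]_(y in A) (expR (kappa th * y - psi th))%:E)%E.

(* The parameter ranges over an open region of R^m (possibly all of it), so as
   to allow response functions that are not defined for every vector.  The
   values of [law] and [eta] outside the region are irrelevant. *)
Record regression_model (R : realType) (X : topologicalType) (m : nat) :=
  RegressionModel {
    region : set 'rV[R]_m ;
    region_open : open region ;
    law : X -> 'rV[R]_m -> probability (measurableTypeR R) R ;
    eta : X -> 'rV[R]_m -> R ;
    law_expfam : forall x, exponential_family region (law x) ;
    law_L2 : forall x th, region th ->
      (idfun : measurableTypeR R -> R) \in Lfun (law x th) 2%:E ;
    law_nondegenerate : forall x th, region th ->
      (0 < variance (law x th) (idfun : measurableTypeR R -> R))%E ;
    eta_mean : forall x th, region th ->
      expectation (law x th) (idfun : measurableTypeR R -> R)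
      = (eta x th)%:E ;
    eta_derivable : forall x th j, region th ->
      derivable (eta x) th (delta_mx 0 j) ;
    eta_continuous_partials : forall x th j, region th ->
      {for th, continuous (fun th' => 'D_(delta_mx 0 j) (eta x) th')}
  }.

Definition cond_var (R : realType) (X : topologicalType) (m : nat)
    (mod : regression_model R X m) (x : X) (th : 'rV[R]_m) : R :=
  fine (variance (law mod x th) (idfun : measurableTypeR R -> R)).

Definition grad_eta (R : realType) (X : topologicalType) (m : nat)
    (mod : regression_model R X m) (x : X) (th : 'rV[R]_m) : 'cV[R]_m :=
  \col_j 'D_(delta_mx 0 j) (eta mod x) th.

Definition fisher_info (R : realType) (X : topologicalType) (m : nat)
    (mod : regression_model R X m) (x : X) (th : 'rV[R]_m) : 'M[R]_m :=
  (cond_var mod x th)^-1 *: (grad_eta mod x th *m (grad_eta mod x th)^T).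

Definition reg_vec (R : realType) (X : topologicalType) (m : nat)
    (mod : regression_model R X m) (x : X) (th : 'rV[R]_m) : 'cV[R]_m :=
  (Num.sqrt (cond_var mod x th))^-1 *: grad_eta mod x th.

Lemma fisher_infoE (R : realType) (X : topologicalType) (m : nat)
    (mod : regression_model R X m) (x : X) (th : 'rV[R]_m) :
  region mod th ->
  fisher_info mod x th = reg_vec mod x th *m (reg_vec mod x th)^T.
Proof.
move=> Dth; rewrite /fisher_info /reg_vec linearZ/= -scalemxAl -scalemxAr.
rewrite scalerA -invfM -expr2 sqr_sqrtr// /cond_var.
have := law_nondegenerate x Dth.
by case: variance => [r| |]//=; rewrite lte_fin => /ltW.
Qed.

(* The square of det(f_i(x_j))_(i,j). *)
Definition I_m (R : realType) (X : topologicalType) (m : nat)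
    (mod : regression_model R X m) (xs : 'I_m -> X) (th : 'rV[R]_m) : R :=
  (\det (\matrix_(i < m, j < m) reg_vec mod (xs j) th i 0)) ^+ 2.

Record design (R : realType) (X : Type) := Design {
  supp_size : nat ;
  pt : 'I_supp_size -> X ;
  wt : 'I_supp_size -> R ;
  pt_inj : injective pt ;
  wt_gt0 : forall k, 0 < wt k ;
  wt_sum1 : \sum_k wt k = 1
}.
Arguments pt {R X} _ _.
Arguments wt {R X} _ _.

Definition info_mx (R : realType) (X : topologicalType) (m : nat)
    (mod : regression_model R X m) (xi : design R X) (th : 'rV[R]_m) :
    'M[R]_m :=
  \sum_k wt xi k *: fisher_info mod (pt xi k) th.

Definition local_D_optimal (R : realType) (X : topologicalType) (m : nat)
    (mod : regression_model R X m) (th : 'rV[R]_m) (xi : design R X) : Prop :=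
  forall xi' : design R X,
    \det (info_mx mod xi' th) <= \det (info_mx mod xi th).

Definition depends_only_on (R : realType) (X : topologicalType) (m : nat)
    (mod : regression_model R X m) (i : 'I_m) : Prop :=
  forall th th' : 'rV[R]_m, region mod th -> region mod th' ->
    th 0 i = th' 0 i ->
    forall xi, local_D_optimal mod th xi <-> local_D_optimal mod th' xi.

(* The parameter vector with [i]-th component [b], the other components being
   fixed at their nominal values. *)
Definition theta_at (R : realType) (m : nat) (th0 : 'rV[R]_m) (i : 'I_m)
    (b : R) : 'rV[R]_m :=
  \row_j (if j == i then b else th0 0 j).

(* [bmin, bmax] with possibly infinite end points, as a set of reals. *)
Definition prior_range (R : realType) (bmin bmax : \bar R) : set R :=
  [set b | (bmin <= b%:E <= bmax)%E].

Definition common_support (R : realType) (X : topologicalType) (m : nat)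
    (mod : regression_model R X m) (th : R -> 'rV[R]_m) (B : set R) : set X :=
  [set x | forall b, B b -> forall xi : design R X,
     local_D_optimal mod (th b) xi -> exists k, pt xi k = x].

(* [lne] is the logarithm with lne 0 = -oo. *)
Definition Psi (R : realType) (X : topologicalType) (m : nat)
    (mod : regression_model R X m) (th : R -> 'rV[R]_m) (B : set R)
    (prior : probability (measurableTypeR R) R) (xi : design R X) : \bar R :=
  (\int[prior]_(b in B) lne (\det (info_mx mod xi (th b)))%:E)%E.

(* Maximality only makes sense when the maximal value is finite: if Psi were
   identically -oo, say, every design would be a maximizer. *)
Definition bayes_D_optimal (R : realType) (X : topologicalType) (m : nat)
    (mod : regression_model R X m) (th : R -> 'rV[R]_m) (B : set R)
    (prior : probability (measurableTypeR R) R) (xi : design R X) : Prop :=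
  Psi mod th B prior xi \is a fin_num /\
  forall xi' : design R X, (Psi mod th B prior xi' <= Psi mod th B prior xi)%E.

Definition Q (R : realType) (X : topologicalType) (m : nat)
    (mod : regression_model R X m) (th : R -> 'rV[R]_m)
    (xiD : R -> design R X) (b b' : R) : R :=
  \det (info_mx mod (xiD b') (th b)) / \det (info_mx mod (xiD b) (th b)).

(* A nondecreasing continuous function on [bmin, bmax]; its values outside
   are irrelevant. *)
Record scale (R : realType) (bmin bmax : \bar R) := Scale {
  scale_fun :> R -> R ;
  scale_nd : {in prior_range bmin bmax &,
              {homo scale_fun : x y / x <= y}} ;
  scale_cont : {within prior_range bmin bmax, continuous scale_fun}
}.

(* l(e) for an end point e, understood as a limit when e is infinite. *)
Definition scale_at (R : realType) (bmin bmax : \bar R)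
    (l : scale bmin bmax) (e : \bar R) : \bar R :=
  match e with
  | r%:E => (l r)%:E
  | +oo%E => lim ((l t)%:E @[t --> +oo])
  | -oo%E => lim ((l t)%:E @[t --> -oo])
  end.

Definition scale_length (R : realType) (bmin bmax : \bar R)
    (l : scale bmin bmax) : \bar R :=
  (scale_at l bmax - scale_at l bmin)%E.

(* Extension to the real line by constants, needed because the
   Lebesgue-Stieltjes measure of the library takes a function on all of R. *)
Definition clamp (R : realType) (bmin bmax : \bar R) (t : R) : R :=
  fine (Order.max bmin (Order.min bmax t%:E)).

Definition scale_ext (R : realType) (bmin bmax : \bar R)
    (l : scale bmin bmax) (t : R) : R := l (clamp bmin bmax t).

Section scale_ext_cumulative.
Variables (R : realType) (bmin bmax : \bar R) (l : scale bmin bmax).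

Lemma clampE :
  clamp bmin bmax = (fun t => match bmin, bmax with
    | r%:E, s%:E => Num.max r (Num.min s t)
    | r%:E, +oo%E => Num.max r t
    | r%:E, -oo%E => r
    | -oo%E, s%:E => Num.min s t
    | -oo%E, +oo%E => t
    | _, _ => 0
    end).
Proof.
apply/funext => t; rewrite /clamp.
case: bmin => [r| |]; case: bmax => [s| |] //;
  rewrite ?minye ?minNye ?maxeNy ?maxNye ?maxye ?maxey //=;
  by rewrite -?EFin_min -?EFin_max.
Qed.

Lemma clamp_cases :
  (forall t, prior_range bmin bmax (clamp bmin bmax t))
  \/ (exists c, forall t, clamp bmin bmax t = c).
Proof.
rewrite clampE /prior_range.
case: bmin => [r| |]; case: bmax => [s| |] /=; try by right; eexists.
- case: (leP r s) => rs.
    by left => t; rewrite !lee_fin le_max lexx/= ge_max rs ge_min lexx.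
  right; exists r => t; apply/max_idPl.
  by rewrite (le_trans _ (ltW rs))// ge_min lexx.
- by left => t; rewrite leey andbT lee_fin le_max lexx.
- by left => t; rewrite leNye/= lee_fin ge_min lexx.
- by left => t; rewrite leNye leey.
Qed.

Lemma clamp_nd : {homo clamp bmin bmax : x y / x <= y}.
Proof.
move=> x y xy; rewrite clampE.
case: bmin => [r| |]; case: bmax => [s| |] //=.
- by rewrite le_max2// le_min2.
- by rewrite le_max2.
- by rewrite le_min2.
Qed.

Lemma clamp_cont : continuous (clamp bmin bmax).
Proof.
rewrite clampE => x.
case: bmin => [r| |]; case: bmax => [s| |]; try exact: cvg_cst;
  try exact: cvg_id.
- apply: continuous_max; first exact: cvg_cst.
  by apply: continuous_min; [exact: cvg_cst|exact: cvg_id].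
- by apply: continuous_max; [exact: cvg_cst|exact: cvg_id].
- by apply: continuous_min; [exact: cvg_cst|exact: cvg_id].
Qed.

Let scale_ext_nd : {homo scale_ext l : x y / x <= y}.
Proof.
move=> x y xy; rewrite /scale_ext.
case: clamp_cases => [h|[c h]]; last by rewrite !h.
by apply: scale_nd; [exact/mem_set/h|exact/mem_set/h|exact: clamp_nd].
Qed.

Let scale_ext_rc : right_continuous (scale_ext l).
Proof.
apply: right_continuousW => x; rewrite /scale_ext.
case: clamp_cases => [h|[c h]]; last first.
  by under eq_fun do rewrite h; exact: cvg_cst.
have lc : l @ within (prior_range bmin bmax) (nbhs (clamp bmin bmax x))
    --> l (clamp bmin bmax x).
  by rewrite (nbhs_subspace_in (h x)); exact: scale_cont.
apply: (cvg_comp (clamp bmin bmax) l _ lc) => A /= wA.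
have := clamp_cont wA; rewrite !nbhs_simpl /=.
by apply: filterS => t; apply.
Qed.

HB.instance Definition _ :=
  isCumulative.Build R _ R (scale_ext l) scale_ext_nd scale_ext_rc.

End scale_ext_cumulative.

Definition scale_measure (R : realType) (bmin bmax : \bar R)
    (l : scale bmin bmax) : {measure set (measurableTypeR R) -> \bar R} :=
  lebesgue_stieltjes_measure (scale_ext l).

(* Main.v *)
(* Suppose that the optimal design xi has at most N points, let D(b) be the
   optimal value of |M(., b)| and L the length of the scale l.  By Cauchy-Binet
   |M(xi, b)| is at most a sum of N^m values of I_m, so (i) and (ii) give at
   most K = N^m m points of the scale such that
   |M(xi, b)| <= C exp(- r^gamma) D(b) as soon as l(b) is at distance at least r
   from all of them.  For r of order L/K the b's with this property have scale
   measure at least L/4, hence prior probability at least c3/4 by (iii).  On the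
   other hand, the uniform mixture xi' of n <= L/lambda + 1 local optimal
   designs, spaced by lambda on the scale, satisfies
   D(b) <= 2 n^m |M(xi', b)| for all b.  So xi loses against xi' at least
   (c3/4) r^gamma - ln (2C) - m ln n, which is positive for large L. *)
Require Import Defs.
From HB Require Import structures.
From mathcomp Require Import all_boot all_order all_algebra all_fingroup.
From mathcomp Require Import all_classical all_reals all_analysis.
From mathcomp Require Import measurable_realfun.
From mathcomp Require Import ring lra.
Set Implicit Arguments.
Unset Strict Implicit.
Unset Printing Implicit Defensive.
Import Order.TTheory GRing.Theory Num.Theory.
Import numFieldNormedType.Exports.
Local Open Scope classical_set_scope.
Local Open Scope ring_scope.


(** * Determinants of information matrices as sums of squared minors *)

(* Cauchy-Binet, summed over all m-tuples of columns instead of the increasing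
   ones, whence the factor m!. *)
Lemma det_sum_outer (R : comNzRingType) (m : nat) (J : finType) (w : J -> R)
    (f : J -> 'cV[R]_m) :
  m`!%:R * \det (\sum_j w j *: (f j *m (f j)^T)) =
  \sum_(k : {ffun 'I_m -> J})
    (\prod_a w (k a)) * (\det (\matrix_(i, j) f (k j) i 0)) ^+ 2.
Proof.
pose d (k : 'I_m -> J) : R := \det (\matrix_(i, j) f (k j) i 0).
have detE k : d k = \sum_(s : 'S_m) (-1) ^+ s * \prod_a f (k a) (s a) 0.
  rewrite /d -det_tr; apply: eq_bigr => s _; congr (_ * _).
  by apply: eq_bigr => a _; rewrite !mxE.
have d_perm k (s : 'S_m) : d (k \o s) = (-1) ^+ s * d k.
  rewrite /d -(det_perm R s) -[LHS]det_tr -[X in _ = _ * X]det_tr -det_mulmx.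
  rewrite -row_permE.
  by congr (\det _); apply/matrixP => i j; rewrite !mxE.
(* Leibniz expansion, with the product over rows distributed: [k] records the summand used in each
   row, and the sum over permutations reassembles into [d k]. *)
have expand : \det (\sum_j w j *: (f j *m (f j)^T)) =
    \sum_(k : {ffun 'I_m -> J})
      (\prod_a w (k a)) * (\prod_a f (k a) a 0) * d k.
  transitivity (\sum_(s : 'S_m) \sum_(k : {ffun 'I_m -> J})
      (-1) ^+ s * \prod_a (w (k a) * f (k a) a 0 * f (k a) (s a) 0)).
    apply: eq_bigr => s _; rewrite -big_distrr /=; congr (_ * _).
    rewrite -(bigA_distr_bigA (fun a j => w j * f j a 0 * f j (s a) 0)).
    apply: eq_bigr => a _; rewrite summxE; apply: eq_bigr => j _.
    by rewrite !mxE big_ord1 !mxE mulrA.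
  rewrite exchange_big; apply: eq_bigr => k _ /=.
  rewrite detE big_distrr; apply: eq_bigr => s _ /=.
  by rewrite !big_split /= mulrCA.
(* One copy per permutation [s], with [k] reindexed by the inverse of [s]: the sign picked up by [d]
   turns the sum over [s] into a second factor [d k]. *)
transitivity (\sum_(s : 'S_m) \det (\sum_j w j *: (f j *m (f j)^T))).
  by rewrite sumr_const card_Sn mulr_natl.
transitivity (\sum_(s : 'S_m) \sum_(k : {ffun 'I_m -> J})
    (\prod_a w (k a)) * d k * ((-1) ^+ s * \prod_a f (k a) (s a) 0)).
  apply: eq_bigr => s _; rewrite expand.
  pose h (k : {ffun 'I_m -> J}) : {ffun 'I_m -> J} := [ffun a => k ((s^-1)%g a)].
  have h_inj : injective h.
    move=> k k' /ffunP e; apply/ffunP => a.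
    by have := e (s a); rewrite !ffunE permK.
  rewrite (reindex_inj h_inj); apply: eq_bigr => k _ /=.
  have -> : d (h k) = (-1) ^+ s * d k.
    rewrite -odd_permV -d_perm; congr (\det _).
    by apply/matrixP => i j; rewrite !mxE ffunE.
  have -> : \prod_a w (h k a) = \prod_a w (k a).
    rewrite (reindex_inj (@perm_inj _ s)).
    by apply: eq_bigr => a _; rewrite ffunE permK.
  have -> : \prod_a f (h k a) a 0 = \prod_a f (k a) (s a) 0.
    rewrite (reindex_inj (@perm_inj _ s)).
    by apply: eq_bigr => a _; rewrite ffunE permK.
  by rewrite mulrAC -!mulrA; congr (_ * _); rewrite mulrC mulrAC -mulrA.
rewrite exchange_big; apply: eq_bigr => k _ /=.
by rewrite -big_distrr /= -detE -mulrA expr2.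
Qed.

Lemma det_fisher_sum (R : realType) (X : topologicalType) (m : nat)
    (mod : regression_model R X m) (th : 'rV[R]_m) (J : finType) (w : J -> R)
    (p : J -> X) : region mod th ->
  m`!%:R * \det (\sum_j w j *: fisher_info mod (p j) th) =
  \sum_(k : {ffun 'I_m -> J})
    (\prod_a w (k a)) * I_m mod (fun a => p (k a)) th.
Proof.
move=> Dth; under eq_bigr do rewrite fisher_infoE//.
exact: (det_sum_outer w (fun j => reg_vec mod (p j) th)).
Qed.

Lemma I_m_ge0 (R : realType) (X : topologicalType) (m : nat)
    (mod : regression_model R X m) (xs : 'I_m -> X) (th : 'rV[R]_m) :
  0 <= I_m mod xs th.
Proof. exact: sqr_ge0. Qed.

(** Times m!, the determinant is a polynomial in the weights with squares as coefficients, hence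
    monotone in nonnegative weights. *)
Lemma det_fisher_sum_le (R : realType) (X : topologicalType) (m : nat)
    (mod : regression_model R X m) (th : 'rV[R]_m) (J : finType)
    (w w' : J -> R) (p : J -> X) :
  region mod th -> (forall j, 0 <= w j <= w' j) ->
  \det (\sum_j w j *: fisher_info mod (p j) th) <=
  \det (\sum_j w' j *: fisher_info mod (p j) th).
Proof.
move=> Dth ww'; rewrite -(@ler_pM2l _ m`!%:R) ?ltr0n ?fact_gt0//.
rewrite !det_fisher_sum//; apply: ler_sum => k _.
by apply: ler_wpM2r; [exact: I_m_ge0|exact: ler_prod].
Qed.

Lemma det_info_mx_ge0 (R : realType) (X : topologicalType) (m : nat)
    (mod : regression_model R X m) (th : 'rV[R]_m) (xi : design R X) :
  region mod th -> 0 <= \det (info_mx mod xi th).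
Proof.
move=> Dth; rewrite -(@pmulr_rge0 _ m`!%:R) ?ltr0n ?fact_gt0//.
rewrite det_fisher_sum//; apply: sumr_ge0 => k _.
by rewrite mulr_ge0 ?I_m_ge0// prodr_ge0// => a _; exact/ltW/wt_gt0.
Qed.

Lemma wt_le1 (R : realType) (X : Type) (xi : design R X) k : wt xi k <= 1.
Proof.
rewrite -(wt_sum1 xi) (bigD1 k)//= lerDl sumr_ge0// => j _.
exact/ltW/wt_gt0.
Qed.

Lemma det_info_mx_le_sum (R : realType) (X : topologicalType) (m : nat)
    (mod : regression_model R X m) (th : 'rV[R]_m) (xi : design R X) :
  region mod th ->
  \det (info_mx mod xi th) <=
  \sum_(k : {ffun 'I_m -> 'I_(supp_size xi)}) I_m mod (fun a => pt xi (k a)) th.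
Proof.
move=> Dth; apply: (@le_trans _ _ (m`!%:R * \det (info_mx mod xi th))).
  by rewrite ler_peMl ?det_info_mx_ge0// ler1n fact_gt0.
rewrite det_fisher_sum//; apply: ler_sum => k _.
rewrite ler_piMl ?I_m_ge0// prodr_ile1// => a _.
by rewrite wt_le1 ltW// wt_gt0.
Qed.

(** * Designs from weighted families of points, and their mixtures *)

(* The family may repeat points, which then get the sum of their weights. *)
Lemma design_of_family (R : realType) (X : eqType) (J : finType) (p : J -> X)
    (w : J -> R) :
  (forall j, 0 < w j) -> \sum_j w j = 1 ->
  exists xi : design R X, forall (V : lmodType R) (g : X -> V),
    \sum_k wt xi k *: g (pt xi k) = \sum_j w j *: g (p j).
Proof.
move=> w_gt0 w_sum; pose s := undup [seq p j | j : J].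
pose P (k : 'I_(size s)) := tnth (in_tuple s) k.
have P_inj : injective P.
  move=> k k' e; apply/val_inj/eqP.
  (* [p j] only serves as default value for [nth], [X] having no given element. *)
  have [j _] : exists2 j : J, true & p j = P k.
    have : P k \in s by exact: mem_tnth.
    by rewrite mem_undup => /mapP[j _ ->]; exists j.
  move=> pj; rewrite -(nth_uniq (p j) (ltn_ord k) (ltn_ord k') (undup_uniq _)).
  by move: e; rewrite /P !(tnth_nth (p j))/= => ->.
have P_idx j : exists k, P k == p j.
  have /tnthP[k ->] : p j \in in_tuple s.
    by rewrite mem_undup; apply/mapP; exists j; rewrite ?mem_enum.
  by exists k.
pose W k := \sum_(j | P k == p j) w j.
pose idx j := xchoose (P_idx j).
have idxE j k : (P k == p j) = (idx j == k).
  rewrite -(eqP (xchooseP (P_idx j))) eq_sym.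
  by apply/eqP/eqP => [/P_inj|<-].
have main (V : lmodType R) (g : X -> V) :
    \sum_k W k *: g (P k) = \sum_j w j *: g (p j).
  rewrite (partition_big idx xpredT)//=; apply: eq_bigr => k _.
  by rewrite scaler_suml; apply: eq_big => j; [exact: idxE|move=> /eqP ->].
have W_gt0 k : 0 < W k.
  have : P k \in s by exact: mem_tnth.
  rewrite mem_undup => /mapP[j _ Pk].
  rewrite /W (bigD1 j) ?Pk//= ltr_wpDr// sumr_ge0// => i _; exact: ltW.
have W_sum : \sum_k W k = 1.
  have := main R^o (fun=> 1); rewrite -!scaler_suml w_sum scale1r.
  by rewrite -[_ *: _]/(_ * _) mulr1.
by exists (Design P_inj W_gt0 W_sum).
Qed.

(** The information matrix of the mixture is the mean of the others, and dropping all but one of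
    them only lowers weights; the power of [n] appears because the determinant is homogeneous of
    degree [m]. *)
Lemma uniform_mixture (R : realType) (X : topologicalType) (m n : nat)
    (xs : 'I_n -> design R X) : (0 < n)%N ->
  exists xi : design R X,
    forall (mod : regression_model R X m) th, region mod th -> forall s,
      n%:R^-1 ^+ m * \det (info_mx mod (xs s) th) <= \det (info_mx mod xi th).
Proof.
move=> n_gt0.
pose J := {s : 'I_n & 'I_(supp_size (xs s))}.
pose p (j : J) := pt (xs (tag j)) (tagged j).
pose w (j : J) := n%:R^-1 * wt (xs (tag j)) (tagged j).
have n_pos : 0 < (n%:R : R)^-1 by rewrite invr_gt0 ltr0n.
have w_gt0 j : 0 < w j by rewrite mulr_gt0// wt_gt0.
have w_sum : \sum_j w j = 1.
  transitivity (\sum_s \sum_k n%:R^-1 * wt (xs s) k).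
    by rewrite (sig_big_dep _ (fun _ _ => true)
      (fun s k => n%:R^-1 * wt (xs s) k)).
  under eq_bigr do rewrite -big_distrr/= wt_sum1 mulr1.
  by rewrite sumr_const card_ord -[RHS](@mulVf R n%:R) ?mulr_natr// pnatr_eq0 -lt0n.
have [xi xiE] := design_of_family p w_gt0 w_sum.
exists xi => mod th Dth s; rewrite -detZ /info_mx.
rewrite (xiE _ (fun x => fisher_info mod x th)).
(* Both sides use the same points; only the weights grow. *)
pose w' (j : J) := if tag j == s then w j else 0.
have -> : n%:R^-1 *: (\sum_k wt (xs s) k *: fisher_info mod (pt (xs s) k) th)
   = \sum_j w' j *: fisher_info mod (p j) th.
  rewrite /w' -(sig_big_dep xpredT (fun _ _ => true) (fun s' k =>
    (if s' == s then n%:R^-1 * wt (xs s') k else 0) *: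
      fisher_info mod (pt (xs s') k) th)) [RHS](bigD1 s)//=.
  rewrite [X in _ + X]big1 ?addr0.
    by rewrite eqxx scaler_sumr; apply: eq_bigr => k _; rewrite scalerA.
  by move=> s' /negPf ->; rewrite big1// => k _; rewrite scale0r.
apply: det_fisher_sum_le => // j; rewrite /w'.
by case: ifP => _; rewrite ?lexx ltW.
Qed.

(** * The scale: end values, length and induced measure *)

Lemma clamp_id (R : realType) (bmin bmax : \bar R) (b : R) :
  prior_range bmin bmax b -> clamp bmin bmax b = b.
Proof.
by move=> /andP[b1 b2]; rewrite /clamp (min_idPr b2) (max_idPr b1).
Qed.

Lemma prior_range_itv (R : realType) (bmin bmax : \bar R) (a b t : R) :
  prior_range bmin bmax a -> prior_range bmin bmax b -> a <= t <= b ->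
  prior_range bmin bmax t.
Proof.
move=> /andP[a1 _] /andP[_ b2] /andP[at_ tb]; apply/andP; split.
  by rewrite (le_trans a1)// lee_fin.
by rewrite (le_trans _ b2)// lee_fin.
Qed.

(** By monotonicity the value at the upper end is the supremum of [l] over the range, also where it
    is defined as a limit. *)
Lemma scale_at_sup (R : realType) (bmin bmax : \bar R) (l : scale bmin bmax)
    (b0 : R) : prior_range bmin bmax b0 ->
  (forall b, prior_range bmin bmax b -> ((l b)%:E <= scale_at l bmax)%E) /\
  (forall y : \bar R, (y < scale_at l bmax)%E ->
     exists2 b, prior_range bmin bmax b & (y < (l b)%:E)%E).
Proof.
move=> Bb0; have lnd := @scale_nd _ _ _ l.
have extE b := @clamp_id _ bmin bmax b.
have extnd := cumulative_is_nondecreasing (scale_ext l : cumulative R R).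
case: bmax l b0 Bb0 lnd extE extnd => [s| |] l b0 Bb0 lnd extE extnd /=.
- have Bs : prior_range bmin s%:E s.
    by case/andP: Bb0 => h1 h2; apply/andP; rewrite lexx (le_trans h1 h2).
  split=> [b Bb|y ys]; last by exists s.
  by rewrite lee_fin lnd ?inE//; case/andP: Bb; rewrite lee_fin.
- have Bge t : b0 <= t -> prior_range bmin +oo t.
    move=> b0t; case/andP: Bb0 => h1 _; apply/andP.
    by rewrite leey (le_trans h1) ?lee_fin.
  (* [l] need not be monotone outside the range, but near +oo it agrees with its monotone
     extension. *)
  have -> : lim ((l t)%:E @[t --> +oo]) =
      ereal_sup (range (fun t => (scale_ext l t)%:E)).
    apply/cvg_lim => //; apply: cvg_trans (nondecreasing_cvge _); last first.
      by move=> x y xy; rewrite lee_fin extnd.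
    apply: near_eq_cvg; near=> t.
    rewrite /scale_ext extE//; apply: Bge; near: t.
    by apply: nbhs_pinfty_ge; exact: num_real.
  split=> [b Bb|y /ereal_sup_gt[_ [t _ <-] yt]].
    by apply: ereal_sup_ubound; exists b => //; rewrite /scale_ext extE.
  have Bt : prior_range bmin +oo (Num.max b0 t) by apply: Bge; rewrite le_max lexx.
  exists (Num.max b0 t) => //; apply: (lt_le_trans yt).
  rewrite lee_fin -[X in _ <= l X]extE//.
  by apply: extnd; rewrite le_max lexx orbT.
- by case/andP: Bb0.
Unshelve. all: by end_near. Qed.

Lemma scale_at_inf (R : realType) (bmin bmax : \bar R) (l : scale bmin bmax)
    (b0 : R) : prior_range bmin bmax b0 ->
  (forall b, prior_range bmin bmax b -> (scale_at l bmin <= (l b)%:E)%E) /\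
  (forall y : \bar R, (scale_at l bmin < y)%E ->
     exists2 b, prior_range bmin bmax b & ((l b)%:E < y)%E).
Proof.
move=> Bb0; have lnd := @scale_nd _ _ _ l.
have extE b := @clamp_id _ bmin bmax b.
have extnd := cumulative_is_nondecreasing (scale_ext l : cumulative R R).
case: bmin l b0 Bb0 lnd extE extnd => [s| |] l b0 Bb0 lnd extE extnd /=.
- have Bs : prior_range s%:E bmax s.
    by case/andP: Bb0 => h1 h2; apply/andP; rewrite lexx (le_trans h1 h2).
  split=> [b Bb|y ys]; last by exists s.
  by rewrite lee_fin lnd ?inE//; case/andP: Bb; rewrite lee_fin.
- by case/andP: Bb0.
- have Ble t : t <= b0 -> prior_range -oo bmax t.
    move=> b0t; case/andP: Bb0 => _ h1; apply/andP.
    by rewrite leNye (le_trans _ h1) ?lee_fin.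
  (* The substitution of [- t] moves the limit to +oo, where the extension becomes nonincreasing. *)
  have -> : lim ((l t)%:E @[t --> -oo]) =
      ereal_inf (range (fun t => (scale_ext l (- t))%:E)).
    apply/cvg_lim => //; apply/cvgNy_compNP.
    apply: cvg_trans (nonincreasing_cvge _); last first.
      by move=> x y xy; rewrite lee_fin extnd// lerN2.
    apply: near_eq_cvg; near=> t.
    rewrite /scale_ext /= extE//; apply: Ble; rewrite lerNl.
    by near: t; apply: nbhs_pinfty_ge; exact: num_real.
  split=> [b Bb|y /ereal_inf_lt[_ [t _ <-] yt]].
    by apply: ereal_inf_lbound; exists (- b) => //; rewrite opprK /scale_ext extE.
  have Bt : prior_range -oo bmax (Num.min b0 (- t)).
    by apply: Ble; rewrite ge_min lexx.
  exists (Num.min b0 (- t)) => //; apply: le_lt_trans yt.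
  rewrite lee_fin -[X in l X <= _]extE//.
  by apply: extnd; rewrite ge_min lexx orbT.
Unshelve. all: by end_near. Qed.

(** A difference of extended reals is finite only if both terms are, so both end values are real;
    [lo] is the lower one. At an infinite end the value may not be attained, whence the slack
    [e]. *)
Lemma scale_length_range (R : realType) (bmin bmax : \bar R)
    (l : scale bmin bmax) (b0 : R) :
  prior_range bmin bmax b0 -> scale_length l \is a fin_num ->
  exists lo,
    (forall b, prior_range bmin bmax b ->
       lo <= l b <= lo + fine (scale_length l)) /\
    (forall e, 0 < e -> exists a b, [/\ prior_range bmin bmax a,
       prior_range bmin bmax b & fine (scale_length l) - e < l b - l a]).
Proof.
move=> Bb0; have [hi1 hi2] := scale_at_sup l Bb0.
have [lo1 lo2] := scale_at_inf l Bb0.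
rewrite /scale_length fin_numB => /andP[].
case: (scale_at l bmax) hi1 hi2 => [hi| |]// hi1 hi2 _.
case: (scale_at l bmin) lo1 lo2 => [lo| |]// lo1 lo2 _ /=.
exists lo; split=> [b Bb|e e_gt0].
  by rewrite (addrC lo) subrK -!lee_fin lo1//= hi1.
have [b Bb hb] : exists2 b, prior_range bmin bmax b & ((hi - e / 2)%:E < (l b)%:E)%E.
  by apply: hi2; rewrite lte_fin; lra.
have [a Ba ha] : exists2 a, prior_range bmin bmax a & ((l a)%:E < (lo + e / 2)%:E)%E.
  by apply: lo2; rewrite lte_fin; lra.
by exists a, b; split => //; move: ha hb; rewrite !lte_fin; lra.
Qed.

Lemma scale_measure_itv (R : realType) (bmin bmax : \bar R)
    (l : scale bmin bmax) (a b : R) :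
  prior_range bmin bmax a -> prior_range bmin bmax b -> a <= b ->
  scale_measure l `]a, b]%classic = (l b - l a)%:E.
Proof.
move=> Ba Bb ab.
rewrite /scale_measure/= /lebesgue_stieltjes_measure/= /measure_extension/=.
rewrite measurable_mu_extE/=; last exact: is_ocitv.
by rewrite wlength_itv_bnd// /scale_ext !clamp_id.
Qed.

(** Since [l] is monotone, the points where it is within [r] of [s] form an interval. By continuity
    its ends have the levels [s - r] and [s + r], unless it is cut off by [a] or [b]. *)
Lemma scale_window (R : realType) (bmin bmax : \bar R) (l : scale bmin bmax)
    (a b s r : R) :
  prior_range bmin bmax a -> prior_range bmin bmax b -> a <= b -> 0 < r ->
  exists u v, [/\ a <= u, u <= v, v <= b, l v - l u <= 2 * r &
    forall t, a < t <= b -> `|l t - s| < r -> u < t <= v].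
Proof.
move=> Ba Bb ab r_gt0.
have Bab t : a <= t <= b -> prior_range bmin bmax t by exact: prior_range_itv.
have lnd x y : a <= x <= b -> a <= y <= b -> x <= y -> l x <= l y.
  by move=> Bx By; apply: scale_nd; rewrite inE; exact: Bab.
have lt_of x y : a <= x <= b -> a <= y <= b -> l x < l y -> x < y.
  move=> Bx By lxy; rewrite ltNge; apply/negP => /(lnd _ _ By Bx).
  by rewrite leNgt lxy.
have ivt v : l a <= v <= l b -> exists2 c, a <= c <= b & l c = v.
  move=> hv; have lab : l a <= l b by apply: lnd; rewrite ?lexx ?ab.
  have [||c] := @IVT R l a b v ab; last by rewrite in_itv/=; exists c.
  - apply: continuous_subspaceW (@scale_cont _ _ _ l) => x /=.
    by rewrite in_itv/=; exact: Bab.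
  - by rewrite (min_idPl lab) (max_idPr lab).
have [[t0 t0ab t0s]|none] := pselect (exists2 t, a < t <= b & `|l t - s| < r);
    last first.
  exists a, a; split; rewrite ?lexx ?subrr//; first by rewrite mulr_ge0// ltW.
  by move=> t tab ts; case: none; exists t.
move: (t0s); rewrite ltr_distl => /andP[t0s1 t0s2].
have t0ab' : a <= t0 <= b by case/andP: t0ab => /ltW -> ->.
have [aa bb] : a <= a <= b /\ a <= b <= b by rewrite !lexx ab.
have lt0a : l a <= l t0 by apply: lnd => //; case/andP: t0ab'.
have lt0b : l t0 <= l b by apply: lnd => //; case/andP: t0ab'.
have [u uab [lu ut]] : exists2 u, a <= u <= b &
    s - r <= l u /\ forall t, a < t <= b -> s - r < l t -> u < t.
  have [sra|sra] := leP (s - r) (l a).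
    by exists a => //; split=> // t /andP[].
  have [|u uab lu] := ivt (s - r).
    by rewrite (ltW sra)/= (le_trans (ltW t0s1)).
  exists u => //; split=> [|t tab st]; first by rewrite lu.
  by apply: lt_of; rewrite ?lu//; case/andP: tab => /ltW -> ->.
have [v vab [lv vt]] : exists2 v, a <= v <= b &
    l v <= s + r /\ forall t, a < t <= b -> l t < s + r -> t <= v.
  have [srb|srb] := leP (l b) (s + r).
    by exists b => //; split=> // t /andP[].
  have [|v vab lv] := ivt (s + r).
    by rewrite (ltW srb) andbT (le_trans _ (ltW t0s2)).
  exists v => //; split=> [|t tab st]; first by rewrite lv.
  by apply/ltW/lt_of; rewrite ?lv//; case/andP: tab => /ltW -> ->.
have utv t : a < t <= b -> `|l t - s| < r -> u < t <= v.
    by move=> tab; rewrite ltr_distl => /andP[? ?]; rewrite ut ?vt.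
exists u, v; split=> //.
- by case/andP: uab.
- by have /andP[ut0 t0v] := utv t0 t0ab t0s; exact/ltW/(lt_le_trans ut0).
- by case/andP: vab.
- lra.
Qed.

(** Induction on the list: removing from []a, b]] the window around one more value costs at most
    [2 * r] of scale measure. *)
Lemma scale_avoid (R : realType) (bmin bmax : \bar R) (l : scale bmin bmax)
    (a b r : R) (ss : seq R) :
  prior_range bmin bmax a -> prior_range bmin bmax b -> a <= b -> 0 < r ->
  exists A : set (measurableTypeR R), [/\ measurable A, A `<=` `]a, b]%classic,
    forall t s, A t -> s \in ss -> r <= `|l t - s| &
    ((l b - l a - (size ss)%:R * (2 * r))%:E <= scale_measure l A)%E].
Proof.
move=> Ba Bb ab r_gt0; elim: ss => [|s ss [A [mA Aab Ass muA]]].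
  exists `]a, b]%classic; split => //; rewrite ?mul0r ?subr0.
  by rewrite scale_measure_itv.
have [u [v [au uv vb luv uvE]]] := scale_window l s Ba Bb ab r_gt0.
have Buv x : u <= x <= v -> prior_range bmin bmax x.
  move=> /andP[ux xv]; apply: (prior_range_itv Ba Bb).
  by rewrite (le_trans au ux) (le_trans xv vb).
have muv : scale_measure l `]u, v]%classic = (l v - l u)%:E.
  by apply: scale_measure_itv => //; apply: Buv; rewrite lexx uv.
have mI : measurable (`]u, v]%classic : set (measurableTypeR R)) by [].
exists (A `\` `]u, v]%classic); split.
- exact: measurableD.
- by move=> x [/Aab].
- move=> t s' [At tuv]; rewrite inE => /predU1P[->|]; last exact: Ass.
  rewrite leNgt; apply/negP => /(uvE t) ut; apply: tuv => /=.
  by rewrite in_itv/=; apply: ut; have := Aab _ At; rewrite /= in_itv.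
- have : (scale_measure l A <=
      scale_measure l (A `\` `]u, v]%classic) + (l v - l u)%:E)%E.
    rewrite -muv; apply: le_trans (measureU2 _ _ mI); last exact: measurableD.
    apply: le_measure; rewrite ?inE//.
      by apply: measurableU => //; exact: measurableD.
    by move=> x Ax; have [?|?] := pselect (`]u, v]%classic x); [right|left].
  move=> /(le_trans muA); rewrite -leeBlDr// -EFinB; apply: le_trans.
  by rewrite lee_fin /= -natr1; lra.
Qed.

(** * Integrals of functions that may take the value -oo *)

Lemma measurable_lne (R : realType) d (T : measurableType d) (D : set T)
    (f : T -> R) : measurable D -> measurable_fun D f ->
  measurable_fun D (fun x => lne (f x)%:E).
Proof.
move=> mD mf; rewrite /lne.
apply: measurable_fun_if => //.
- exact: measurable_fun_ler.
- apply/measurable_EFinP; apply: measurableT_comp; first exact: measurable_ln.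
  exact: measurable_funS mf.
Qed.

(** Positive and negative parts are compared separately, so that the integrals may be infinite, as
    for the log-determinants of a competing design. *)
Lemma le_integral_measurable (R : realType) d (T : measurableType d)
    (mu : {measure set T -> \bar R}) (D : set T) (f g : T -> \bar R) :
  measurable D -> measurable_fun D f -> measurable_fun D g ->
  (forall x, D x -> (f x <= g x)%E) ->
  (\int[mu]_(x in D) f x <= \int[mu]_(x in D) g x)%E.
Proof.
move=> mD mf mg fg.
have fgD : {in D, forall x, (f x <= g x)%E} by move=> x; rewrite inE; exact: fg.
rewrite integralE [leRHS]integralE; apply: leeB; apply: ge0_le_integral => //.
- exact: measurable_funepos.
- exact: measurable_funepos.
- by move=> x Dx; apply: (funepos_le fgD); rewrite inE.
- exact: measurable_funeneg.
- exact: measurable_funeneg.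
- by move=> x Dx; apply: (funeneg_le fgD); rewrite inE.
Qed.

Lemma integral_fin_num_integrable (R : realType) d (T : measurableType d)
    (mu : {measure set T -> \bar R}) (D : set T) (f : T -> \bar R) :
  measurable D -> measurable_fun D f ->
  (\int[mu]_(x in D) f x)%E \is a fin_num -> mu.-integrable D f.
Proof.
move=> mD mf; rewrite integralE fin_numB => /andP[fp fn].
apply/integrableP; split => //.
under eq_integral do rewrite -[`|f _|%E]/((abse \o f) _) fune_abse.
rewrite ge0_integralD//; last 2 first.
- exact: measurable_funepos.
- exact: measurable_funeneg.
by rewrite lte_add_pinfty// ltey_eq ?fp ?fn.
Qed.

(** Integrating over [B], of probability 1, bounds the integral of [f] plus [t * P A - K] by that of
    [g], hence by that of [f], which is finite and cancels. In use [f] and [g] are the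
    log-determinants of two designs, [t] a gain on [A] and [K] a loss allowed everywhere. *)
Lemma prob_gain_le (R : realType) d (T : measurableType d)
    (P : probability T R) (B A : set T) (f g : T -> \bar R) (K t : R) :
  measurable B -> P B = 1%E -> measurable A -> A `<=` B ->
  measurable_fun B f -> measurable_fun B g ->
  (\int[P]_(x in B) f x)%E \is a fin_num ->
  (\int[P]_(x in B) g x <= \int[P]_(x in B) f x)%E ->
  (forall x, B x -> (f x + (t * \1_A x - K)%:E <= g x)%E) ->
  t * fine (P A) <= K.
Proof.
move=> mB PB mA AB mf mg ffin gf fg.
have intf := integral_fin_num_integrable mB mf ffin.
pose fA x : R := t * \1_A x.
have intA : P.-integrable B (EFin \o fA).
  have := integrable_indic P mA; move/(integrableS measurableT mB (@subsetT _ _)).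
  exact: integrableZl.
have intK : P.-integrable B (EFin \o (fun=> - K)).
  exact: finite_measure_integrable_cst.
have ih : P.-integrable B (f \+ ((EFin \o fA) \+ (EFin \o (fun=> (- K)%R))))%E.
  by apply: integrableD => //; exact: integrableD.
have : (\int[P]_(x in B)
   (f \+ ((EFin \o fA) \+ (EFin \o (fun=> (- K)%R)))) x
     <= \int[P]_(x in B) f x)%E.
  apply: le_trans gf; apply: le_integral_measurable => //.
  by case/integrableP: ih.
rewrite integralD//; last exact: integrableD.
rewrite integralD//.
have -> : (\int[P]_(x in B) ((EFin \o (fun=> (- K)%R)) x) = (- K)%:E)%E.
  apply: etrans (integral_cst P mB (- K)%:E) _.
  by rewrite -[RHS]mule1; congr (_ * _)%E; exact: PB.
have -> : (\int[P]_(x in B) (t * \1_A x)%:E = t%:E * P A)%E.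
  under eq_integral do rewrite EFinM.
  rewrite integralZl//; last first.
    exact: (integrableS measurableT mB (@subsetT _ _) (integrable_indic P mA)).
  by rewrite integral_indic// setIidl.
have PAE : P A = (fine (P A))%:E by rewrite fineK// fin_num_measure.
rewrite PAE /= -(fineK ffin) -!EFinM -!EFinD lee_fin; lra.
Qed.

(** * Estimates for long scales: growth, nets, designs with few points *)

Lemma log_affine_lt_powR (R : realType) (a b k c gamma : R) :
  0 <= b -> 0 < k -> 0 < c -> 0 < gamma ->
  exists2 L0 : R, 1 <= L0 & forall L, L0 <= L ->
    a + b * ln (k * L + 1) < c * L `^ gamma.
Proof.
move=> b_ge0 k_gt0 c_gt0 gamma_gt0.
(* With [u = L ^ (gamma / 2)] the logarithm is at most affine in [u], while the
   right-hand side is quadratic. *)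
pose a' := `|a| + b * `|ln (k + 1)|; pose b' := 2 * b / gamma.
have a'_ge0 : 0 <= a' by rewrite addr_ge0// mulr_ge0.
have b'_ge0 : 0 <= b' by rewrite divr_ge0// ?mulr_ge0// ltW.
(* Chosen so that [c * u0 = a' + b' + c]; the extra [c] makes the final inequality strict. *)
pose u0 := (a' + b') / c + 1.
have u0_ge1 : 1 <= u0 by rewrite lerDr; apply: divr_ge0 (addr_ge0 _ _) (ltW c_gt0).
have u0_ge0 : 0 <= u0 by rewrite (le_trans _ u0_ge1).
exists (Num.max 1 (u0 `^ (2 / gamma))) => [|L]; first by rewrite le_max lexx.
rewrite ge_max => /andP[L_ge1 u0L].
have L_gt0 : 0 < L by rewrite (lt_le_trans _ L_ge1).
pose u := L `^ (gamma / 2).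
have u_gt0 : 0 < u by exact: powR_gt0.
have uu : L `^ gamma = u * u.
  by rewrite -powRD ?(gt_eqF L_gt0) ?implybT// -splitr.
have u0u : u0 <= u.
  have -> : u0 = (u0 `^ (2 / gamma)) `^ (gamma / 2).
    rewrite -powRrM mulrA divfK ?gt_eqF// divff ?powRr1//.
  by apply: ge0_ler_powR; rewrite ?nnegrE ?powR_ge0 ?divr_ge0 // ltW.
have lnL : ln L <= (2 / gamma) * u.
  have -> : ln L = (2 / gamma) * ln u.
    by rewrite ln_powR; field; rewrite gt_eqF.
  by rewrite ler_pM2l ?divr_gt0//; exact/ltW/ln_sublinear.
have lnkL : ln (k * L + 1) <= `|ln (k + 1)| + (2 / gamma) * u.
  apply: le_trans (lerD (ler_norm _) lnL); rewrite -lnM ?posrE ?addr_gt0//.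
  rewrite ler_ln ?posrE ?mulr_gt0 ?addr_gt0 ?mulr_gt0//.
  by rewrite mulrDl mul1r lerD2l.
have blnkL : b * ln (k * L + 1) <= b * `|ln (k + 1)| + b' * u.
  apply: (le_trans (ler_wpM2l b_ge0 lnkL)); rewrite mulrDr lerD2l /b'.
  by rewrite le_eqVlt; apply/orP; left; apply/eqP; field; rewrite gt_eqF.
have cu : a' + b' + c <= c * u.
  apply: le_trans (ler_wpM2l (ltW c_gt0) u0u).
  by rewrite /u0 mulrDr mulr1 mulrCA divff ?gt_eqF// mulr1.
rewrite uu mulrA; apply: (@lt_le_trans _ _ ((a' + b' + c) * u)); last first.
  by rewrite ler_wpM2r// ltW.
have u_ge1 : 1 <= u by exact: le_trans u0u.
have := ler_norm a; have : a' <= a' * u by rewrite ler_peMr.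
have : 0 < c * u by rewrite mulr_gt0.
move: blnkL; rewrite /a'; nra.
Qed.

Lemma prior_range_measurable (R : realType) (bmin bmax : \bar R) :
  measurable (prior_range bmin bmax : set (measurableTypeR R)).
Proof.
apply: is_interval_measurable => x y Bx By z xzy.
exact: prior_range_itv xzy.
Qed.

(** The values of [l] are sorted into cells of length [lambda], and one point is kept from each cell
    that is met. *)
Lemma scale_net (R : realType) (bmin bmax : \bar R) (l : scale bmin bmax)
    (b0 lo L lambda : R) :
  prior_range bmin bmax b0 -> 0 < lambda ->
  (forall b, prior_range bmin bmax b -> lo <= l b <= lo + L) ->
  exists (n : nat) (c : 'I_n -> R), [/\ (0 < n)%N, n%:R <= lambda^-1 * L + 1,
    forall s, prior_range bmin bmax (c s) &
    forall b, prior_range bmin bmax b -> exists s, `|l b - l (c s)| <= lambda].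
Proof.
move=> Bb0 lam_gt0 lE; pose idx b := Num.truncn (lambda^-1 * (l b - lo)).
(* Cells are numbered from 0 up to the integer part of [L / lambda], hence the successor. *)
pose n := (Num.truncn (lambda^-1 * L)).+1.
have idxP b : prior_range bmin bmax b ->
    (idx b)%:R * lambda <= l b - lo < (idx b).+1%:R * lambda.
  move=> /lE /andP[lob _].
  have /truncn_itv /andP[h1 h2] : 0 <= lambda^-1 * (l b - lo).
    by rewrite mulr_ge0 ?invr_ge0 ?(ltW lam_gt0)// subr_ge0.
  by rewrite -ler_pdivlMr// -ltr_pdivrMr// mulrC h1 h2.
have idx_lt b : prior_range bmin bmax b -> (idx b < n)%N.
  move=> /lE /andP[_ lob]; apply: le_truncn.
  by rewrite ler_pM2l ?invr_gt0//; lra.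
have /choice[c cP] : forall s : 'I_n, exists c, prior_range bmin bmax c /\
    forall b, prior_range bmin bmax b -> idx b = s -> idx c = s.
  move=> s.
  have [[c Bc cs]|none] := pselect (exists2 c, prior_range bmin bmax c & idx c = s).
    by exists c.
  (* A cell that is not met gets [b0], its second clause being vacuous. *)
  by exists b0; split=> // b Bb bs; case: none; exists b.
exists n, c; split=> //.
- rewrite /n -natr1 lerD2r truncn_le.
  have /andP[h1 h2] := lE _ Bb0.
  by rewrite mulr_ge0 ?invr_ge0 ?(ltW lam_gt0)//; lra.
- by move=> s; have [] := cP s.
move=> b Bb; exists (Ordinal (idx_lt b Bb)).
set s := Ordinal _; have [Bc /(_ b Bb erefl) cs] := cP s.
have := idxP _ Bb; have := idxP _ Bc; rewrite cs /= -natr1 => /andP[? ?] /andP[? ?].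
by rewrite ler_norml; apply/andP; split; lra.
Qed.

Lemma det_few_points (R : realType) (X : topologicalType) (m N : nat)
    (mod : regression_model R X m) (th : R -> 'rV[R]_m) (bmin bmax : \bar R)
    (l : scale bmin bmax) (phi : R -> R) (c0 c1 gamma : R)
    (xiD : R -> design R X) (xi : design R X) :
  let B := prior_range bmin bmax in
  (forall b, B b -> region mod (th b)) ->
  (forall b, B b -> 0 < \det (info_mx mod (xiD b) (th b))) ->
  (forall xs : 'I_m -> X, exists bt : 'I_m -> R, (forall j, B (bt j)) /\
     forall b, B b -> `|I_m mod xs (th b)| <=
       c0 * \sum_j \det (info_mx mod (xiD (bt j)) (th b))) ->
  (forall b b', B b -> B b' -> Q mod th xiD b b' <= phi (l b - l b')) ->
  (forall z, phi z <= c1 * expR (- (`|z| `^ gamma))) ->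
  0 < c1 -> 0 < gamma -> (0 < m)%N -> (supp_size xi <= N)%N ->
  exists2 ss : seq R, (size ss <= N ^ m * m)%N &
    forall b r, B b -> 0 <= r -> (forall s, s \in ss -> r <= `|l b - s|) ->
      \det (info_mx mod xi (th b)) <= (N ^ m * m)%:R * (`|c0| * c1) *
        expR (- (r `^ gamma)) * \det (info_mx mod (xiD b) (th b)).
Proof.
move=> B th_region D_gt0 Im_bound Q_le phi_le c1_gt0 gamma_gt0 m_gt0 le_N.
pose I := {ffun 'I_m -> 'I_(supp_size xi)}.
have /choice[bt btP] := fun k : I => Im_bound (fun a => pt xi (k a)).
have card_le : (#|{: I * 'I_m}| <= N ^ m * m)%N.
  by rewrite card_prod card_ffun !card_ord leq_mul2r leq_exp2r// le_N orbT.
exists [seq l (bt p.1 p.2) | p : I * 'I_m].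
  by rewrite size_map -cardE.
move=> b r Bb r_ge0 far; set D := \det (info_mx mod (xiD b) (th b)).
have D_pos : 0 < D by exact: D_gt0.
set E := c1 * expR (- (r `^ gamma)) * D.
have E_ge0 : 0 <= E by rewrite !mulr_ge0 ?expR_ge0// ltW.
have Mle k j : \det (info_mx mod (xiD (bt k j)) (th b)) <= E.
  have [/(_ j) Bt _] := btP k; rewrite -ler_pdivrMr//.
  apply: le_trans (Q_le _ _ Bb Bt) _; apply: le_trans (phi_le _) _.
  rewrite ler_pM2l// ler_expR lerN2.
  apply: ge0_ler_powR; rewrite ?nnegrE// ?(ltW gamma_gt0)//.
  by apply: far; apply/mapP; exists (k, j); rewrite ?mem_enum.
apply: le_trans (det_info_mx_le_sum _ (th_region _ Bb)) _.
apply: (@le_trans _ _ (\sum_(k : I) \sum_(j < m) `|c0| * E)).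
  apply: ler_sum => k _; have [Bt /(_ b Bb)] := btP k.
  move=> /(le_trans (ler_norm _)) /le_trans; apply.
  rewrite -big_distrr /=; set S := \sum_j _.
  have S_ge0 : 0 <= S.
    by apply: sumr_ge0 => j _; apply: det_info_mx_ge0; exact: th_region.
  apply: (@le_trans _ _ (`|c0| * S)); first by rewrite ler_wpM2r// ler_norm.
  by rewrite ler_wpM2l// /S; apply: ler_sum => j _; exact: Mle.
rewrite pair_big sumr_const/= -[leLHS]mulr_natl.
apply: (@le_trans _ _ ((N ^ m * m)%:R * (`|c0| * E))).
  by apply: ler_wpM2r; [exact: mulr_ge0|rewrite ler_nat].
by rewrite /E !mulrA.
Qed.

(** * The design with few points against the mixture *)

Theorem theorem4p1 (R : realType) (m N : nat) (c0 c1 gamma lambda c3 : R)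
    (c1_gt0 : 0 < c1) (gamma_gt0 : 0 < gamma) (lambda_gt0 : 0 < lambda)
    (c3_gt0 : 0 < c3) :
  exists L0 : R,
  forall (X : topologicalType) (X_compact : compact [set: X])
    (mod : regression_model R X m)
    (* beta is the i-th component of theta; th0 gives the other ones *)
    (i : 'I_m) (mod_beta : depends_only_on mod i)
    (th0 : 'rV[R]_m) (bmin bmax : \bar R) (bmin_le_bmax : (bmin <= bmax)%E),
  let B := prior_range bmin bmax in
  let th := theta_at th0 i in
  let M xi b := info_mx mod xi (th b) in
  forall (th_region : forall b, B b -> region mod (th b))
    (xiD : R -> design R X)
    (xiD_opt : forall b, B b -> local_D_optimal mod (th b) (xiD b))
    (m_eta : nat) (m_etaE : (common_support mod th B #= `I_m_eta)%card)
    (m_eta_lt : (m_eta < m)%N)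
    (prior : probability (measurableTypeR R) R) (prior_B : prior B = 1%E)
    (* the integrands of the criterion are measurable *)
    (M_measurable : forall xi : design R X,
       measurable_fun (B : set (measurableTypeR R)) (fun b => \det (M xi b)))
    (* (i) *)
    (Im_bound : forall xs : 'I_m -> X,
       exists bt : 'I_m -> R, (forall j, B (bt j)) /\
         forall b, B b ->
           `|I_m mod xs (th b)| <= c0 * \sum_j \det (M (xiD (bt j)) b))
    (* (ii) *)
    (l : scale bmin bmax) (phi : R -> R)
    (Q_le : forall b b', B b -> B b' ->
       Q mod th xiD b b' <= phi (l b - l b'))
    (phi_le : forall z, phi z <= c1 * expR (- (`|z| `^ gamma)))
    (Q_ge : forall b b', B b -> B b' ->
       `|l b - l b'| <= lambda -> 2^-1 <= Q mod th xiD b b')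
    (* (iii) *)
    (scale_length_fin : scale_length l \is a fin_num)
    (prior_ge : forall A : set (measurableTypeR R), measurable A -> A `<=` B ->
       (\int[scale_measure l]_(b in A) (c3 / fine (scale_length l))%:E
        <= \int[prior]_(b in A) 1)%E)
    (large : L0 <= fine (scale_length l)),
  forall xi : design R X, bayes_D_optimal mod th B prior xi ->
    (N < supp_size xi)%N.
Proof.
(* [K0] bounds the number of scale values to avoid. [C] joins the constant of [det_few_points] with
   the factor 2 from [Q >= 1/2]; the added 1 keeps it positive, so that its logarithm splits off. *)
pose K0 : R := (N ^ m * m)%:R; pose C := 2 * (K0 * (`|c0| * c1) + 1).
have K0_ge0 : 0 <= K0 by exact: ler0n.
have KC_ge0 : 0 <= K0 * (`|c0| * c1) by rewrite !mulr_ge0// ltW.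
have C_gt0 : 0 < C by rewrite /C; lra.
(* With [r = q * L], at most [K0] windows of length [2 * r] remove at most a quarter of [L]. *)
pose q := (8 * (K0 + 1))^-1.
have q_gt0 : 0 < q by rewrite invr_gt0; lra.
have c_gt0 : 0 < c3 / 4 * q `^ gamma by rewrite mulr_gt0 ?powR_gt0// divr_gt0.
have lamV_gt0 : 0 < lambda^-1 by rewrite invr_gt0.
(* The threshold depends on the constants alone; the slope [lambda^-1] comes from the size of the
   net. *)
have [L0 L0_ge1 L0P] :=
  log_affine_lt_powR (ln C) (ler0n R m) lamV_gt0 c_gt0 gamma_gt0.
exists L0 => X X_compact mod i mod_beta th0 bmin bmax _ B th M th_region xiD xiD_opt.
move=> _ _ _ prior prior_B M_measurable Im_bound l phi Q_le phi_le Q_ge.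
move=> length_fin prior_ge large xi [Psi_fin Psi_max].
rewrite ltnNge; apply/negP => le_N.
set L := fine (scale_length l) in prior_ge large *.
have m_gt0 : (0 < m)%N by apply: leq_trans (ltn_ord i).
have mB : measurable (B : set (measurableTypeR R)) by exact: prior_range_measurable.
have [b0 Bb0] : exists b, B b.
  apply: contrapT => noB; have B0 : B = set0.
    by apply/seteqP; split=> // b Bb; case: noB; exists b.
  by move: prior_B; rewrite B0 measure0 => /eqP; rewrite eq_sym onee_eq0.
have L_gt0 : 0 < L by apply: lt_le_trans large; apply: lt_le_trans L0_ge1.
have D_gt0 b : B b -> 0 < \det (M (xiD b) b).
  move=> Bb; rewrite lt_neqAle det_info_mx_ge0 ?andbT; last exact: th_region.
  (* Otherwise [Q b b] is [0 / 0 = 0], against [Q b b >= 1/2]. *)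
  apply/negP => /eqP D0; have := Q_ge _ _ Bb Bb.
  rewrite subrr normr0 => /(_ (ltW lambda_gt0)).
  by rewrite /Q -D0 mul0r leNgt invr_gt0 ltr0n.
have [ss ss_size few] := det_few_points th_region D_gt0 Im_bound Q_le phi_le
  c1_gt0 gamma_gt0 m_gt0 le_N.
have [lo [l_range l_spread]] := scale_length_range Bb0 length_fin.
have [n [c [n_gt0 nL Bc c_net]]] := scale_net Bb0 lambda_gt0 l_range.
have [xi' xi'P] := uniform_mixture m (fun s => xiD (c s)) n_gt0.
(* The ends of the scale may not be attained, but two points more than half its length apart
   exist. *)
have [a [b [Ba Bb]]] := l_spread (L / 2) (divr_gt0 L_gt0 (ltr0n _ 2)).
rewrite -/L => lab.
have ab : a <= b.
  rewrite leNgt; apply/negP => /ltW ba.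
  by have := @scale_nd _ _ _ l b a; rewrite !inE => /(_ Bb Ba ba); lra.
pose r := q * L.
have r_gt0 : 0 < r by rewrite mulr_gt0.
have [A [mA Aab Afar muA]] := scale_avoid l ss Ba Bb ab r_gt0.
have AB : A `<=` B.
  move=> t /Aab /=; rewrite in_itv/= => /andP[a_t tb].
  by apply: (prior_range_itv Ba Bb); rewrite (ltW a_t).
(* [A] has scale measure at least [L / 2 - L / 4], which (iii) turns into probability [c3 / 4]. *)
have PA : c3 / 4 <= fine (prior A).
  have := prior_ge A mA AB.
  rewrite integral_cst// integral_cst// mul1e.
  rewrite -[leRHS]fineK ?fin_num_measure//.
  move=> /(le_trans (lee_wpmul2l _ muA)); rewrite -EFinM !lee_fin.
  move=> /(_ (divr_ge0 (ltW c3_gt0) (ltW L_gt0))); apply: le_trans.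
  have -> : c3 / 4 = c3 / L * (L / 4) by field; rewrite gt_eqF.
  rewrite ler_pM2l ?divr_gt0//.
  have : (size ss)%:R * (2 * r) <= K0 * (2 * r).
    by rewrite ler_pM2r ?ler_nat// mulr_gt0.
  have : K0 * (2 * r) <= L / 4.
    have -> : L / 4 = (K0 + 1) * (2 * r).
      by rewrite /r /q; field; rewrite gt_eqF//; lra.
    by rewrite ler_pM2r ?mulr_gt0//; lra.
  lra.
pose t := r `^ gamma.
(* Pointwise, [xi'] loses at most [ln C + m ln n] against [xi] and gains [t] on [A]; optimality of
   [xi] forbids a positive balance. *)
have gain : t * fine (prior A) <= ln C + m%:R * ln n%:R.
  apply: (@prob_gain_le _ _ _ prior B A
    (fun b => lne (\det (M xi b))%:E) (fun b => lne (\det (M xi' b))%:E)) => //.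
  - by apply: measurable_lne => //; exact: M_measurable.
  - by apply: measurable_lne => //; exact: M_measurable.
  - exact: Psi_max.
  move=> x Bx; have [s xs] := c_net x Bx.
  have Dx := D_gt0 x Bx.
  have n_pos : 0 < n%:R :> R by rewrite ltr0n.
  (* The net point [c s] within [lambda] of [x] on the scale gives [Q >= 1/2], and the mixture costs
     a further factor [n^m]. *)
  have D_le : \det (M (xiD x) x) <= 2 * n%:R ^+ m * \det (M xi' x).
    have := Q_ge _ _ Bx (Bc s) xs; rewrite /Q ler_pdivlMr// => h.
    have := xi'P mod _ (th_region _ Bx) s.
    rewrite exprVn mulrC ler_pdivrMr ?exprn_gt0// => h'.
    rewrite -mulrA -ler_pdivrMl// (le_trans h)// mulrC.
    by rewrite (le_trans h')// mulrC.
  have M'_gt0 : 0 < \det (M xi' x).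
    move: (lt_le_trans Dx D_le); rewrite pmulr_rgt0//.
    by apply: mulr_gt0; rewrite ?exprn_gt0.
  have [Mx|Mx] := leP (\det (M xi x)) 0.
    by rewrite le0_lneNy ?lee_fin// addNye leNye.
  rewrite !lne_EFin// -EFinD lee_fin.
  (* The radius [r * \1_A x] covers both cases, [0 `^ gamma] being [0]. *)
  have rA_far s' : s' \in ss -> r * \1_A x <= `|l x - s'|.
    rewrite indicE; have [xA|_] := boolP (x \in A); last by rewrite mulr0.
    by rewrite mulr1; apply: Afar; move: xA; rewrite inE.
  have rA_pow : (r * \1_A x) `^ gamma = t * \1_A x.
    rewrite indicE; case: (x \in A); rewrite ?mulr1// !mulr0.
    by rewrite powR0// gt_eqF.
  have := few x _ Bx _ rA_far; rewrite rA_pow mulr_ge0// ?(ltW r_gt0)//.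
  move=> /(_ isT) M_le.
  have {}M_le : \det (M xi x) <=
      C * n%:R ^+ m * expR (- (t * \1_A x)) * \det (M xi' x).
    apply: (le_trans M_le).
    apply: (@le_trans _ _ ((K0 * (`|c0| * c1) + 1) * expR (- (t * \1_A x)) *
      (2 * n%:R ^+ m * \det (M xi' x)))).
      apply: ler_pM => //; [|exact: ltW|].
        by rewrite mulr_ge0// expR_ge0.
      by rewrite ler_wpM2r ?expR_ge0// lerDl.
    by rewrite le_eqVlt; apply/orP; left; apply/eqP; rewrite /C; ring.
  have Cn_gt0 : 0 < C * n%:R ^+ m by rewrite mulr_gt0 ?exprn_gt0.
  have CnE_gt0 : 0 < C * n%:R ^+ m * expR (- (t * \1_A x)).
    by apply: mulr_gt0 => //; exact: expR_gt0.
  have : ln (\det (M xi x)) <=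
      ln (C * n%:R ^+ m * expR (- (t * \1_A x)) * \det (M xi' x)).
    by rewrite ler_ln// posrE; exact: mulr_gt0.
  rewrite lnM ?posrE// lnM ?posrE ?expR_gt0// lnM ?posrE ?exprn_gt0//.
  rewrite expRK lnXn//.
  rewrite -mulr_natl; lra.
(* By [PA] the gain is at least [c3 / 4 * r^gamma], while [n <= lambda^-1 * L + 1] bounds the loss,
   contrary to the choice of [L0]. *)
have := L0P L large; apply/negP; rewrite -leNgt.
apply: (@le_trans _ _ (t * fine (prior A))).
  have -> : c3 / 4 * q `^ gamma * L `^ gamma = t * (c3 / 4).
    by rewrite /t /r powRM ?(ltW q_gt0) ?(ltW L_gt0)//; ring.
  by rewrite ler_pM2l// powR_gt0.
apply: (le_trans gain); rewrite lerD2l ler_wpM2l// ler_ln ?posrE ?ltr0n//.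
by rewrite ltr_wpDl// mulr_ge0 ?ltW.
Qed.
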